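(* $\mathrm{FO}(<,\lhd)$ is strictly less expressive than $\mathrm{FO}(\mathrm{Bit})$ on the class of all finite structures: every $\mathrm{FO}(<,\lhd)$-formula is equivalent on all finite structures to an $\mathrm{FO}(\mathrm{Bit})$-formula, but not conversely.
   Context: Built-in predicates: a $k$-ary numerical predicate $P\subseteq\mathbb{N}^k$ is interpreted on a finite structure with universe $[n]=\{0,\dots,n\}$ as $P^n=P\cap[n]^k$. For a list $\ell$ of such predicates, $\mathrm{FO}(\ell)$ is first-order logic over finite structures with universe $[n]$ (arbitrary $n$, arbitrary finite relational signature) that may additionally use symbols for the predicates in $\ell$, interpreted as $P^n$. $<$ is the usual order on $\mathbb{N}$ and $\mathrm{Bit}=\{(a,i)\in\mathbb{N}^2 : 2\nmid\lfloor a/2^i\rfloor\}$. Let $q_i=\frac{i(i+1)}{2}$; for $x\in\mathbb{N}$ let $c(x)=\max\{i: q_i\le x\}$ and $r(x)=x-q_{c(x)}$. The linear order $\lhd$ on $\mathbb{N}$: $x\lhd y$ iff $r(x)<r(y)$, or $r(x)=r(y)$ and $c(x)<c(y)$. *)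

(* Defs.v *)
From mathcomp Require Import all_boot.
Set Implicit Arguments. Unset Strict Implicit. Unset Printing Implicit Defensive.

(** A finite relational signature: a finite type [S] of relation symbols with
    arities [sar].  A list of built-in predicates: a type [B] of symbols with
    arities [bar].  Variables are natural numbers. *)
Inductive form (S : Type) (sar : S -> nat) (B : Type) (bar : B -> nat) : Type :=
| FEq  of nat & nat
| FRel (s : S) of ('I_(sar s) -> nat)
| FBi  (b : B) of ('I_(bar b) -> nat)
| FNot of form sar bar
| FAnd of form sar bar & form sar bar
| FEx  of nat & form sar bar.

Definition upd (a : nat -> nat) (x v : nat) : nat -> nat :=
  fun y => if y == x then v else a y.

(** Satisfaction in the structure with universe [n] = {0..n}, relation
    interpretation [I] (restricted to [n]^k), built-in predicates [P]
    interpreted as [P^n = P ∩ [n]^k], and assignment [a]. *)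
Fixpoint sat (S : Type) (sar : S -> nat) (B : Type) (bar : B -> nat)
    (P : forall b : B, seq nat -> bool)
    (n : nat) (I : forall s : S, seq nat -> bool)
    (a : nat -> nat) (f : form sar bar) : Prop :=
  match f with
  | FEq x y => a x = a y
  | FRel s xs => let t := [seq a (xs i) | i <- enum 'I_(sar s)] in
                 I s t /\ all (fun v => v <= n) t
  | FBi b xs => let t := [seq a (xs i) | i <- enum 'I_(bar b)] in
                P b t /\ all (fun v => v <= n) t
  | FNot g => ~ sat P n I a g
  | FAnd g h => sat P n I a g /\ sat P n I a h
  | FEx x g => exists v, v <= n /\ sat P n I (upd a x v) g
  end.

Definition equiv_fo (S : Type) (sar : S -> nat)
    (B1 : Type) (bar1 : B1 -> nat) (P1 : forall b : B1, seq nat -> bool)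
    (B2 : Type) (bar2 : B2 -> nat) (P2 : forall b : B2, seq nat -> bool)
    (f : form sar bar1) (g : form sar bar2) : Prop :=
  forall (n : nat) (I : forall s : S, seq nat -> bool) (a : nat -> nat),
    (forall x, a x <= n) -> (sat P1 n I a f <-> sat P2 n I a g).

Definition Bit (a i : nat) : bool := odd (a %/ 2 ^ i).

Definition qtri (i : nat) : nat := (i * i.+1) %/ 2.
(** c(x) = max { i : q_i <= x }  (any such i satisfies i <= x). *)
Definition ctri (x : nat) : nat := \max_(i < x.+1 | qtri i <= x) i.
Definition rtri (x : nat) : nat := x - qtri (ctri x).
Definition tri (x y : nat) : bool :=
  (rtri x < rtri y) || ((rtri x == rtri y) && (ctri x < ctri y)).

Inductive LtTriSym := SymLt | SymTri.
Definition ltTri_ar (_ : LtTriSym) : nat := 2.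
Definition ltTri_int (b : LtTriSym) (t : seq nat) : bool :=
  match b with
  | SymLt => nth 0 t 0 < nth 0 t 1
  | SymTri => tri (nth 0 t 0) (nth 0 t 1)
  end.

Inductive BitSym := SymBit.
Definition bit_ar (_ : BitSym) : nat := 2.
Definition bit_int (b : BitSym) (t : seq nat) : bool :=
  match b with SymBit => Bit (nth 0 t 0) (nth 0 t 1) end.

Definition FO_lt_tri (S : Type) (sar : S -> nat) := form sar ltTri_ar.
Definition FO_bit (S : Type) (sar : S -> nat) := form sar bit_ar.

(* Main.v *)
Require Import Defs.
From mathcomp Require Import all_boot zify ring.
Set Implicit Arguments. Unset Strict Implicit. Unset Printing Implicit Defensive.

(** Inclusion.  Reading a number as the set of the positions of its binary
    digits, [Bit] is membership between hereditarily finite sets and [<] obeys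
    Ackermann's recursion: [x < y] iff some [z] in [y \ x] exceeds all of
    [x \ y].  Restricted to the elements of elements of elements of the
    universe, the order is coded by a single element, the set of its initial
    segments; two steps of the recursion extend it to the universe.
    A run of length [t] through states with [d] bits is coded by an element as
    soon as [(t + 1) d] is at most [log2 n], so reachability in [t] steps is
    definable from the one-step relation; nesting this eight times gives runs
    of length [t^8], which is more than enough for the [O(log^2 n)] steps of
    long multiplication, whose states have [O(log log n)] bits.  Hence
    [x = h e + r] is definable on all large universes, and with it the
    coordinates [ctri] and [rtri]; small universes are tabulated.

    Strictness.  On a universe made of full rows, [<] and the triangular order
    only compare the coordinates [ctri] and [rtri], so an Ehrenfeucht game on
    [FO(<)] for the linear order of the coordinates (two moves per move) shows
    that a formula cannot tell the first entries of two consecutive rows that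
    are far from both ends; their parities may differ. *)

(** * Binary digits *)

Lemma Bit0 a : Bit a 0 = odd a.
Proof. by rewrite /Bit expn0 divn1. Qed.

Lemma BitS a i : Bit a i.+1 = Bit a./2 i.
Proof. by rewrite /Bit expnS divnMA divn2. Qed.

Lemma Bit_0n i : Bit 0 i = false.
Proof. by rewrite /Bit div0n. Qed.

Lemma Bit_exp a i : Bit a i -> 2 ^ i <= a.
Proof. by rewrite /Bit; case: leqP => // h; rewrite divn_small. Qed.

Lemma Bit_ltn a i : Bit a i -> i < a.
Proof. by move/Bit_exp; apply: leq_trans; apply: ltn_expl. Qed.

Lemma Bit_lt_exp a i k : a < 2 ^ k -> Bit a i -> i < k.
Proof.
move=> h /Bit_exp h2; rewrite -(@ltn_exp2l 2) //; exact: leq_ltn_trans h2 h.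
Qed.

(** The witness is the highest position where the digits differ, found in the halves unless these
    are equal. *)
Lemma Bit_lt_mono a b :
  a < b -> exists z, [/\ Bit b z, ~~ Bit a z & forall t, Bit a t -> ~~ Bit b t -> t < z].
Proof.
elim/ltn_ind: b a => b IH a ab.
have [hab|hab] := ltnP a./2 b./2.
  have [|z [h1 h2 h3]] := IH b./2 _ a./2 hab; first by lia.
  exists z.+1; rewrite !BitS; split=> // -[|t] //; rewrite !BitS; exact: h3.
have e : a./2 = b./2 by lia.
exists 0; rewrite !Bit0; split; [lia | lia | case=> [|t]]; first by rewrite !Bit0; lia.
by rewrite !BitS e => ->.
Qed.

Lemma Bit_ltP a b :
  a < b <-> exists z, [/\ Bit b z, ~~ Bit a z & forall t, Bit a t -> ~~ Bit b t -> t < z].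
Proof.
split; first exact: Bit_lt_mono.
case=> z [h1 h2 h3]; case: (ltngtP a b) => // [ba|e]; last by rewrite e h1 in h2.
have [y [g1 g2 g3]] := Bit_lt_mono ba.
by have := h3 _ g1 g2; have := g3 _ h1 h2; lia.
Qed.

Lemma Bit_inj a b : (forall i, Bit a i = Bit b i) -> a = b.
Proof.
move=> h; case: (ltngtP a b) => // /Bit_lt_mono [z []]; first by rewrite h => ->.
by rewrite h => ->.
Qed.

Lemma Bit_inj_le n a b : a <= n -> b <= n ->
  (forall i, i <= n -> Bit a i = Bit b i) -> a = b.
Proof.
move=> an bn h; apply: Bit_inj => i; case: (leqP i n) => [|ni]; first exact: h.
by apply/idP/idP => /Bit_ltn; lia.
Qed.

Fixpoint of_bits (f : nat -> bool) (k : nat) : nat :=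
  if k is k'.+1 then f 0 + (of_bits (fun i => f i.+1) k').*2 else 0.

Lemma of_bits_lt f k : of_bits f k < 2 ^ k.
Proof.
elim: k f => [|k IH] f //=; have := IH (fun i => f i.+1).
by rewrite expnS; case: (f 0); lia.
Qed.

Lemma Bit_of_bits f k i : Bit (of_bits f k) i = (i < k) && f i.
Proof.
elim: k f i => [|k IH] f i /=; first by rewrite Bit_0n.
case: i => [|i]; first by rewrite Bit0 oddD odd_double oddb addbF.
by rewrite BitS half_bit_double IH ltnS.
Qed.

Lemma Bit_pred_expn i j : Bit (2 ^ i).-1 j = (j < i).
Proof.
elim: i j => [|i IH] j; first by rewrite Bit_0n.
have e : (2 ^ i.+1).-1 = 1 + ((2 ^ i).-1).*2.
  by rewrite expnS; have := expn_gt0 2 i; lia.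
rewrite e; case: j => [|j]; first by rewrite Bit0 oddD odd_double.
by rewrite BitS (half_bit_double _ true) IH.
Qed.

Lemma Bit_cat p i k m : i < 2 ^ k ->
  Bit (p * 2 ^ k + i) m = if m < k then Bit i m else Bit p (m - k).
Proof.
elim: k i m => [|k IH] i m.
  by rewrite expn0 ltnS leqn0 => /eqP->; rewrite muln1 addn0 subn0.
rewrite expnS => hi.
have e : (p * (2 * 2 ^ k) + i)./2 = p * 2 ^ k + i./2.
  by rewrite mulnCA mul2n -[i in LHS]odd_double_half addnCA -doubleD half_bit_double.
case: m => [|m].
  by rewrite !Bit0 oddD oddM oddM andbF.
rewrite !BitS e IH ?ltnS ?subSS //; lia.
Qed.

Lemma modn_expS a i : a %% 2 ^ i.+1 = a %% 2 ^ i + Bit a i * 2 ^ i.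
Proof.
have hr : a %% 2 ^ i < 2 ^ i by rewrite ltn_mod expn_gt0.
have e : a = (a %/ 2 ^ i)./2 * 2 ^ i.+1 + (a %% 2 ^ i + Bit a i * 2 ^ i).
  rewrite {1}(divn_eq a (2 ^ i)) -{1}[a %/ 2 ^ i]odd_double_half expnS.
  by rewrite mulnDl -mul2n [_ + a %% _]addnC addnA addnC mulnA [_./2 * 2]mulnC.
by rewrite {1}e modnMDl modn_small // expnS; case: (Bit a i); lia.
Qed.

(** * Definability with the built-in predicate Bit *)

(** Named so that [solve_def_with] can recognise a bounded quantifier by its head. *)
Definition exb (n : nat) (P : nat -> Prop) : Prop := exists v, v <= n /\ P v.
Definition allb (n : nat) (P : nat -> Prop) : Prop := forall v, v <= n -> P v.

Lemma exb_dec n P : (forall v, P v \/ ~ P v) -> exb n P \/ ~ exb n P.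
Proof.
move=> dP; elim: n => [|n [[v [h1 h2]]|h]].
- case: (dP 0) => h; first by left; exists 0.
  by right=> -[v []]; rewrite leqn0 => /eqP ->.
- by left; exists v; split=> //; apply: leqW.
- case: (dP n.+1) => h'; first by left; exists n.+1.
  right=> -[v []]; rewrite leq_eqVlt => /orP[/eqP->//|vn hv].
  by apply: h; exists v.
Qed.

Section Definability.
Variables (S : finType) (sar : S -> nat).
Notation bform := (FO_bit sar).

(** Quantifiers range over a finite universe. This replaces classical logic when universal
    quantifiers, disjunctions and implications are expressed by the connectives of [form]. *)
Lemma sat_dec B bar (P : forall b : B, seq nat -> bool) n I a (f : form sar bar) :
  sat P n I a f \/ ~ sat P n I a f.
Proof.
elim: f a => [x y|s xs|b xs|f IH|f IHf g IHg|x f IH] a /=.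
- by case: (a x =P a y); [left|right].
- by case: (I s _) (all _ _) => [] []; [left | right; case ..].
- by case: (P b _) (all _ _) => [] []; [left | right; case ..].
- by case: (IH a); tauto.
- by case: (IHf a); case: (IHg a); tauto.
- exact: exb_dec.
Qed.

Lemma sat_bit n I a (x y : nat) :
  (forall z, a z <= n) ->
  sat bit_int n I a (@FBi S sar BitSym bit_ar SymBit
     (fun i : 'I_(bit_ar SymBit) => if val i == 0 then x else y)) <-> Bit (a x) (a y).
Proof.
move=> an /=; rewrite /bit_ar !enum_ordSl enum_ord0 /= /Bit !an /=.
by split=> // -[].
Qed.

(* A context is any type [T] carrying the size [N] of the universe and the
   values [vs] of the variables in scope; predicates on contexts are shallowly
   embedded, and [s] names the variables of the formula that defines them. *)
Definition def (T : Type) (N : T -> nat) (vs : seq (T -> nat)) (P : T -> Prop) : Prop :=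
  forall s : seq nat, size s = size vs -> exists g : bform,
  forall (t : T) I a, (forall z, a z <= N t) ->
    [seq a i | i <- s] = [seq v t | v <- vs] -> (sat bit_int (N t) I a g <-> P t).

Definition Var (T : Type) (vs : seq (T -> nat)) (f : T -> nat) : Prop :=
  exists2 i, i < size vs & forall t, f t = nth 0 [seq v t | v <- vs] i.

(** A quantified value is paired with the context and placed first, as with de Bruijn indices. *)
Definition up (T : Type) (vs : seq (T -> nat)) : seq (T * nat -> nat) :=
  snd :: [seq (fun p => v p.1) | v <- vs].

Lemma Var_here (T : Type) (vs : seq (T -> nat)) : Var (up vs) (fun p => p.2).
Proof. by exists 0. Qed.

Lemma map_up (T : Type) (vs : seq (T -> nat)) p :
  [seq v p | v <- up vs] = p.2 :: [seq v p.1 | v <- vs].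
Proof. by rewrite /= -map_comp. Qed.

Lemma Var_up (T : Type) (vs : seq (T -> nat)) f :
  Var vs f -> Var (up vs) (fun p => f p.1).
Proof.
case=> i h1 h2; exists i.+1; first by rewrite /= size_map.
by move=> p; rewrite map_up /= h2.
Qed.

Section Rules.
Variables (T : Type) (N : T -> nat) (vs : seq (T -> nat)).
Notation D := (def N vs).

Lemma Var_assign f : Var vs f -> forall s, size s = size vs ->
  exists x, forall t (a : nat -> nat), [seq a i | i <- s] = [seq v t | v <- vs] -> a x = f t.
Proof.
case=> i hi hf s hs; exists (nth 0 s i) => t a e; rewrite hf -e.
by rewrite (nth_map 0) // hs.
Qed.

(** The values in scope come from an assignment into the universe, so only contexts with bounded
    values matter. *)
Lemma def_ext P Q :
  (forall t, (forall f, Var vs f -> f t <= N t) -> (P t <-> Q t)) -> D P -> D Q.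
Proof.
move=> h hP s hs; have [g hg] := hP s hs; exists g => t I a an e.
rewrite hg //; apply: h => f /Var_assign/(_ s hs) [x hx].
by rewrite -(hx t a).
Qed.

Lemma def_bit f g : Var vs f -> Var vs g -> D (fun t => Bit (f t) (g t)).
Proof.
move=> /Var_assign vf /Var_assign vg s hs.
have [x hx] := vf s hs; have [y hy] := vg s hs.
exists (@FBi S sar BitSym bit_ar SymBit (fun i : 'I_(bit_ar SymBit) => if val i == 0 then x else y)).
by move=> t I a an e; rewrite sat_bit // (hx t a e) (hy t a e).
Qed.

Lemma def_eq f g : Var vs f -> Var vs g -> D (fun t => f t = g t).
Proof.
move=> /Var_assign vf /Var_assign vg s hs.
have [x hx] := vf s hs; have [y hy] := vg s hs.
by exists (FEq _ _ x y) => t I a an e /=; rewrite (hx t a e) (hy t a e).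
Qed.

Lemma def_not P : D P -> D (fun t => ~ P t).
Proof.
move=> hP s hs; have [g hg] := hP s hs; exists (FNot g) => t I a an e /=.
by rewrite (hg t I a an e).
Qed.

Lemma def_and P Q : D P -> D Q -> D (fun t => P t /\ Q t).
Proof.
move=> hP hQ s hs; have [g hg] := hP s hs; have [g' hg'] := hQ s hs.
exists (FAnd g g') => t I a an e /=.
by rewrite (hg t I a an e) (hg' t I a an e).
Qed.

Lemma def_quantifier (Q : T -> nat -> Prop) :
  def (fun p => N p.1) (up vs) (fun p => Q p.1 p.2) ->
  forall s, size s = size vs -> exists (x : nat) (g : bform), forall t I a, (forall z, a z <= N t) ->
    [seq a i | i <- s] = [seq v t | v <- vs] ->
    forall v, v <= N t -> (sat bit_int (N t) I (upd a x v) g <-> Q t v).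
Proof.
(* Larger than every name in [s], hence fresh. *)
move=> hQ s hs; pose x := (sumn s).+1.
have hx i : i \in s -> (i == x) = false.
  move=> hi; apply/eqP => e; have : i <= sumn s; last by rewrite e ltnn.
  elim: s hi {hs x e} => //= y s IH; rewrite inE => /orP[/eqP->|/IH]; lia.
have [|g hg] := hQ (x :: s); first by rewrite /= hs size_map.
exists x, g => t I a an e v vn; apply: (hg (t, v)) => [z|].
  by rewrite /upd; case: ifP.
rewrite map_up /= {1}/upd eqxx -e; congr cons.
by apply/eq_in_map => i /hx; rewrite /upd => ->.
Qed.

Lemma def_exb (Q : T -> nat -> Prop) :
  def (fun p => N p.1) (up vs) (fun p => Q p.1 p.2) -> D (fun t => exb (N t) (Q t)).
Proof.
move=> /def_quantifier hQ s /hQ [x [g hg]]; exists (FEx x g) => t I a an e /=.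
by split=> -[v [vn hv]]; exists v; split=> //; apply/(hg t I a an e v vn).
Qed.

Lemma def_allb (Q : T -> nat -> Prop) :
  def (fun p => N p.1) (up vs) (fun p => Q p.1 p.2) -> D (fun t => allb (N t) (Q t)).
Proof.
move=> /def_quantifier hQ s /hQ [x [g hg]].
exists (FNot (FEx x (FNot g))) => t I a an e /=; split=> [h v vn|h [v [vn]]].
  apply/(hg t I a an e v vn).
  have [//|h'] := sat_dec bit_int (N t) I (upd a x v) g.
  by case: h; exists v.
by apply; apply/(hg t I a an e v vn); apply: h.
Qed.

Lemma def_or P Q : D P -> D Q -> D (fun t => P t \/ Q t).
Proof.
move=> hP hQ s hs; have [g hg] := hP s hs; have [g' hg'] := hQ s hs.
exists (FNot (FAnd (FNot g) (FNot g'))) => t I a an e /=.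
have := hg t I a an e; have := hg' t I a an e.
have := sat_dec bit_int (N t) I a g; have := sat_dec bit_int (N t) I a g'; tauto.
Qed.

Lemma def_imp P Q : D P -> D Q -> D (fun t => P t -> Q t).
Proof.
move=> hP hQ s hs; have [g hg] := hP s hs; have [g' hg'] := hQ s hs.
exists (FNot (FAnd g (FNot g'))) => t I a an e /=.
have := hg t I a an e; have := hg' t I a an e.
have := sat_dec bit_int (N t) I a g; have := sat_dec bit_int (N t) I a g'; tauto.
Qed.

Lemma def_iff P Q : D P -> D Q -> D (fun t => P t <-> Q t).
Proof. by move=> hP hQ; apply: def_and; apply: def_imp. Qed.

End Rules.
End Definability.

Ltac solve_var :=
  lazymatch goal with
  | |- Var (up _) (fun p => p.2) => exact: Var_here
  | |- Var (up _) snd => exact: Var_here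
  | |- Var (up ?vs) ?F =>
      (* A variable of the smaller context ignores the new value, so the dummy [0] removes it. *)
      let f := eval cbn beta iota delta [fst snd] in (fun t => F (t, 0)) in
      apply: (@Var_up _ vs f); solve_var
  | |- _ => assumption
  end.

Ltac solve_def_with tac :=
  lazymatch goal with
  | |- def _ _ _ (fun t => _ /\ _) => apply: def_and; solve_def_with tac
  | |- def _ _ _ (fun t => _ \/ _) => apply: def_or; solve_def_with tac
  | |- def _ _ _ (fun t => ~ _) => apply: def_not; solve_def_with tac
  | |- def _ _ _ (fun t => _ <-> _) => apply: def_iff; solve_def_with tac
  | |- def _ _ _ (fun t => _ -> _) => apply: def_imp; solve_def_with tac
  | |- def _ _ _ (fun t => exb _ _) => apply: def_exb; solve_def_with tac
  | |- def _ _ _ (fun t => allb _ _) => apply: def_allb; solve_def_with tac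
  | |- def _ _ _ (fun t => is_true (Bit _ _)) => apply: def_bit; solve_var
  | |- def _ _ _ (fun t => _ = _) => apply: def_eq; solve_var
  | |- _ => tac
  end.

(** * The order *)

(* the members of [w] are meant to be initial segments of the order *)
Definition chain_lt (n w u v : nat) : Prop :=
  exb n (fun s => Bit w s /\ (Bit s u /\ ~ Bit s v)).
(** One unfolding of Ackermann's recursion, with [r] in place of the order between members. *)
Definition ack_lt (n : nat) (r : nat -> nat -> Prop) (x y : nat) : Prop :=
  exb n (fun z => (Bit y z /\ ~ Bit x z) /\
    allb n (fun t => Bit x t -> ~ Bit y t -> r t z)).
Definition rank3 (n t : nat) : Prop :=
  exb n (fun u => Bit u t /\ exb n (fun x => Bit x u)).
(** Since [w] is guessed by a quantifier, a first-order test must certify it: Ackermann's recursion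
    is enough, having a single solution on [rank3]. *)
Definition chain_ok (n w : nat) : Prop :=
  allb n (fun u => allb n (fun v => rank3 n u -> rank3 n v ->
    (chain_lt n w u v <-> ack_lt n (chain_lt n w) u v))).
Definition bit_lt (n x y : nat) : Prop :=
  exb n (fun w => chain_ok n w /\ ack_lt n (ack_lt n (chain_lt n w)) x y).

Lemma ack_ltP n (r : nat -> nat -> Prop) x y : x <= n -> y <= n ->
  (forall t z, Bit x t -> Bit y z -> (r t z <-> t < z)) -> ack_lt n r x y <-> x < y.
Proof.
move=> xn yn hr; rewrite Bit_ltP; split=> [[z [zn [[h1 /negP h2] h3]]]|[z [h1 h2 h3]]].
  exists z; split=> // t xt yt; apply/hr => //; apply: h3 => //; last exact/negP.
  by have := Bit_ltn xt; lia.
exists z; split; first by have := Bit_ltn h1; lia.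
split; first by split=> //; apply/negP.
by move=> t tn xt /negP yt; apply/hr => //; apply: h3.
Qed.

Lemma rank3_exp n t : rank3 n t -> 2 ^ 2 ^ t <= n.
Proof.
case=> u [_ [/Bit_exp ut [x [xn /Bit_exp xu]]]].
by apply: leq_trans xn; apply: leq_trans xu; rewrite leq_exp2l.
Qed.

Lemma rank3_mem n s t : rank3 n t -> Bit t s -> rank3 n s.
Proof.
move=> [u [un [ut _]]] ts; exists t; split; first by have := Bit_ltn ut; lia.
by split=> //; exists u.
Qed.

(** Members are smaller than the set containing them and stay within [rank3], so induction on
    [u + v] applies. *)
Lemma chain_okP n w u v : chain_ok n w -> rank3 n u -> rank3 n v ->
  (chain_lt n w u v <-> u < v).
Proof.
move=> hw hu hv.
have [m] := ubnP (u + v); elim: m u v hu hv => // m IH u v hu hv uvm.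
have le t : rank3 n t -> t <= n.
  by case=> y [yn [/Bit_ltn]]; lia.
rewrite (hw u (le u hu) v (le v hv) hu hv); apply: ack_ltP; try exact: le.
move=> t z ut vz; apply: IH; first exact: rank3_mem ut.
  exact: rank3_mem vz.
by have := Bit_ltn ut; have := Bit_ltn vz; lia.
Qed.

Lemma bit_lt_sound n w x y : chain_ok n w -> x <= n -> y <= n ->
  ack_lt n (ack_lt n (chain_lt n w)) x y <-> x < y.
Proof.
move=> hw xn yn; apply: ack_ltP => // t z xt yz; apply: ack_ltP.
- by have := Bit_ltn xt; lia.
- by have := Bit_ltn yz; lia.
move=> t' z' tt' zz'; apply: chain_okP => //.
  by exists t; split; [have := Bit_ltn xt; lia | split=> //; exists x].
by exists z; split; [have := Bit_ltn yz; lia | split=> //; exists y].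
Qed.

(* [w] codes the set of the initial segments {0, .., i-1} = 2^i - 1 for i <= T,
   where T is the largest number with 2^2^T <= n *)
Lemma chain_ok_exists n : exists2 w, w <= n & chain_ok n w.
Proof.
(* For [n <= 1] the set [rank3] is empty and any [w] will do. *)
have [n1|n2] := leqP n 1.
  exists 0 => // u un v vn [y [yn [uy [x [xn /Bit_exp xy]]]]].
  by have := Bit_ltn uy; case: y xy yn {uy} => [|[|y]]; rewrite ?expnS; lia.
pose T := trunc_log 2 (trunc_log 2 n).
have hT t : 2 ^ 2 ^ t <= n -> t <= T.
  by move=> h; rewrite !trunc_log_max.
have TL : 2 ^ T <= trunc_log 2 n by apply: trunc_logP; rewrite // trunc_log_max.
have Tn : 2 ^ 2 ^ T <= n.
  apply: (@leq_trans (2 ^ trunc_log 2 n)); first by rewrite leq_exp2l.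
  by apply: trunc_logP => //; lia.
(* The largest member, [2 ^ T - 1], is below [2 ^ T], so this many bits suffice and [w] stays below
   [2 ^ 2 ^ T]. *)
pose w := of_bits (fun q => [exists i : 'I_T.+1, q == (2 ^ i).-1]) (2 ^ T).
exists w; first by apply: leq_trans Tn; apply/ltnW/of_bits_lt.
have key u v : u <= T -> v <= T -> chain_lt n w u v <-> u < v.
  move=> uT vT; split.
    case=> s [sn []]; rewrite Bit_of_bits => /andP[_ /existsP[i /eqP->]].
    by rewrite !Bit_pred_expn; lia.
  move=> uv; have vv : 2 ^ v <= 2 ^ T by rewrite leq_exp2l.
  have v0 := expn_gt0 2 v.
  (* The segment {0, .., v-1} contains [u] but not [v]. *)
  exists (2 ^ v).-1; split; first by have := ltn_expl (2 ^ T) (isT : 1 < 2); lia.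
  rewrite Bit_of_bits !Bit_pred_expn uv ltnn; split=> //.
  apply/andP; split; first by lia.
  by apply/existsP; exists (Ordinal (vT : v < T.+1)).
move=> u un v vn /rank3_exp/hT uT /rank3_exp/hT vT; rewrite key //.
symmetry; apply: ack_ltP => // t z /Bit_ltn ut /Bit_ltn vz; apply: key; lia.
Qed.

Lemma bit_ltP n x y : x <= n -> y <= n -> bit_lt n x y <-> x < y.
Proof.
move=> xn yn; split=> [[w [_ [hw]]]|xy]; first by rewrite bit_lt_sound.
have [w wn hw] := chain_ok_exists n.
by exists w; split=> //; split=> //; rewrite bit_lt_sound.
Qed.

Lemma def_lt (S : finType) (sar : S -> nat) T (N : T -> nat) vs f g :
  Var vs f -> Var vs g -> def sar N vs (fun t => f t < g t).
Proof.
move=> hf hg; apply: (@def_ext _ _ _ _ _ (fun t => bit_lt (N t) (f t) (g t))).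
  by move=> t b; apply: bit_ltP; apply: b.
rewrite /bit_lt /chain_ok /ack_lt /chain_lt /rank3.
solve_def_with idtac.
Qed.

Ltac solve_def_lt tac :=
  solve_def_with ltac:(idtac; lazymatch goal with
  | |- def _ _ _ (fun t => is_true (_ < _)) => apply: def_lt; solve_var
  | |- _ => tac
  end).

(** * Reachability *)

(** A named relation, so that [solve_def_with] does not take it for an equality of variables. *)
Definition is_succ (x y : nat) : Prop := y = x.+1.

Lemma def_succ (S : finType) (sar : S -> nat) T (N : T -> nat) vs f g :
  Var vs f -> Var vs g -> def sar N vs (fun t => is_succ (f t) (g t)).
Proof.
move=> hf hg; apply: (@def_ext _ _ _ _ _ (fun t => f t < g t /\
  allb (N t) (fun z => ~ (f t < z /\ z < g t)))); last by solve_def_lt idtac.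
move=> t b; rewrite /is_succ; have := b _ hf; have := b _ hg.
move: (f t) (g t) (N t) => x y n yn xn; split=> [[h1 h2]|->]; last by split=> // z; lia.
by have := h2 x.+1; lia.
Qed.

Notation state := (nat * nat * nat)%type.

Definition exs (n : nat) (P : state -> Prop) : Prop :=
  exb n (fun a => exb n (fun b => exb n (fun u => P (a, b, u)))).

Definition bounded (n : nat) (s : state) : Prop := [/\ s.1.1 <= n, s.1.2 <= n & s.2 <= n].

(* [v] is read from [d] bits of [w] at position [p].  No addition is needed: when
   [d] is a power of two dividing [p], the bits of [p + i] are those of [p] or [i]. *)
Definition block (n d w p v : nat) : Prop :=
  allb n (fun i => Bit v i <-> (i < d /\
    exb n (fun q => allb n (fun k => Bit q k <-> (Bit p k \/ Bit i k)) /\ Bit w q))).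

Definition block3 (n d : nat) (w : state) (p : nat) (s : state) : Prop :=
  block n d w.1.1 p s.1.1 /\ (block n d w.1.2 p s.1.2 /\ block n d w.2 p s.2).

(* [M] is the set of the positions of the successive states coded by [w] *)
Definition reach (n : nat) (R : state -> state -> Prop) (s s' : state) : Prop :=
  exs n (fun w => exb n (fun M => exb n (fun d =>
    exb n (fun p => Bit M p /\ block3 n d w p s) /\
    allb n (fun p => Bit M p -> (block3 n d w p s' \/
      exb n (fun p' => p < p' /\ (Bit M p' /\
        exs n (fun x => exs n (fun y =>
          block3 n d w p x /\ (block3 n d w p' y /\ R x y)))))))))).

Lemma exsP n P : exs n P <-> exists s, bounded n s /\ P s.
Proof.
split=> [[a [ha [b [hb [u [hu h]]]]]]|[[[a b] u] [[ha hb hu] h]]].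
  by exists (a, b, u).
by exists a; split=> //; exists b; split=> //; exists u.
Qed.

Lemma block_inj n d w p v v' : v <= n -> v' <= n ->
  block n d w p v -> block n d w p v' -> v = v'.
Proof.
move=> vn vn' h h'; apply: (@Bit_inj_le n) => // i ni.
by apply/idP/idP => [/(h i ni)/(h' i ni)|/(h' i ni)/(h i ni)].
Qed.

Lemma block3_inj n d w p s s' : bounded n s -> bounded n s' ->
  block3 n d w p s -> block3 n d w p s' -> s = s'.
Proof.
case: s s' => [[a b] u] [[a' b'] u'] [/= ha hb hu] [/= ha' hb' hu'].
case=> /= [h1 [h2 h3]] [/= g1 [g2 g3]].
by rewrite (block_inj ha ha' h1 g1) (block_inj hb hb' h2 g2) (block_inj hu hu' h3 g3).
Qed.

(** Nothing is assumed about the guessed codes. The positions strictly increase inside a finite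
    universe, so following them ends at a block of [s']; a block determines its state, so
    consecutive steps fit together. *)
Lemma reach_invariant n R (I : state -> Prop) :
  (forall x y, bounded n x -> bounded n y -> R x y -> I x -> I y) ->
  forall s s', bounded n s -> bounded n s' -> reach n R s s' -> I s -> I s'.
Proof.
move=> hI s s' sn sn' /exsP [w [_ [M [_ [d [_ [[p [pn [Mp ps]]] hM]]]]]]] Is.
have [m] := ubnP (n - p); elim: m p s sn pn Mp ps Is => // m IH p s sn pn Mp ps Is pm.
case: (hM p pn Mp) => [h|]; first by rewrite -(block3_inj sn sn' ps h).
case=> p' [pn' [pp' [Mp' /exsP[x [xn /exsP[y [yn [px [py xy]]]]]]]]].
apply: (IH p' y) => //; last by lia.
by apply: (hI x) => //; rewrite -(block3_inj sn xn ps px).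
Qed.

(** * Runs coded by single elements *)

Section Completeness.
Variables (n L k t : nat).
Hypothesis Ln : 2 ^ L <= n.
Let d := 2 ^ k.
Hypothesis dL : t.+1 * d <= L.

Let Ln' : L < n.
Proof. by apply: leq_trans Ln; apply: ltn_expl. Qed.

Definition code (f : nat -> nat) := of_bits (fun q => Bit (f (q %/ d)) (q %% d)) L.

Lemma code_le f : code f <= n.
Proof. by apply: leq_trans Ln; apply/ltnW/of_bits_lt. Qed.

Lemma block_code f j : j <= t -> f j < 2 ^ d -> block n d (code f) (j * d) (f j).
Proof.
move=> jt fj i ni; have d0 : 0 < d by rewrite expn_gt0.
have jd : (j.+1) * d <= L by apply: leq_trans dL; rewrite leq_mul2r; lia.
have Bq m : i < d -> Bit (j * d + i) m = Bit (j * d) m || Bit i m.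
  move=> id; rewrite -[j * d in RHS]addn0 !Bit_cat // ?expn_gt0 // Bit_0n.
  case: ltnP => // km; rewrite orbC; case b: (Bit i m) => //.
  by have := Bit_lt_exp id b; lia.
have Bc : i < d -> Bit (code f) (j * d + i) = Bit (f j) i.
  move=> id; rewrite Bit_of_bits divnMDl // divn_small // addn0 modnMDl modn_small //.
  by rewrite (_ : j * d + i < L) //; apply: leq_trans jd; rewrite mulSn; lia.
split=> [b|[id [q [qn [hq bq]]]]].
  have id : i < d by apply: Bit_lt_exp b.
  split=> //; exists (j * d + i); split; first by rewrite mulSn in jd; lia.
  by split; [move=> m _; rewrite Bq //; split=> /orP | rewrite Bc].
suff e : q = j * d + i by rewrite -Bc // -e.
apply: (@Bit_inj_le n) => //; first by rewrite mulSn in jd; lia.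
by move=> m mn; rewrite Bq //; apply/idP/orP => /(hq m mn).
Qed.

Definition small (s : state) := [/\ s.1.1 < 2 ^ d, s.1.2 < 2 ^ d & s.2 < 2 ^ d].

Lemma small_bounded s : small s -> bounded n s.
Proof.
have : 2 ^ d <= 2 ^ L by rewrite leq_exp2l //; move: dL; rewrite mulSn; lia.
by move=> h0 [h1 h2 h3]; split; lia.
Qed.

Lemma reach_path R (v : nat -> state) :
  (forall j, j <= t -> small (v j)) -> (forall j, j < t -> R (v j) (v j.+1)) ->
  reach n R (v 0) (v t).
Proof.
move=> sv Rv; have d0 : 0 < d by rewrite expn_gt0.
pose w : state :=
  (code (fun j => (v j).1.1), code (fun j => (v j).1.2), code (fun j => (v j).2)).
have bw j : j <= t -> block3 n d w (j * d) (v j).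
  move=> jt; have [h1 h2 h3] := sv j jt; split; first exact: (@block_code (fun j => (v j).1.1)).
  by split; [exact: (@block_code (fun j => (v j).1.2)) | exact: (@block_code (fun j => (v j).2))].
have jL j : j <= t -> j * d < L.
  by move=> jt; apply: leq_trans dL; rewrite mulSn -add1n leq_add // leq_mul2r jt orbT.
pose M := of_bits (fun q => (d %| q) && (q <= t * d)) L.
have MP j : j <= t -> Bit M (j * d).
  by move=> jt; rewrite Bit_of_bits jL // dvdn_mull // leq_mul2r jt orbT.
apply/exsP; exists w; split; first by split; exact: code_le.
exists M; split; first by apply: leq_trans Ln; apply/ltnW/of_bits_lt.
exists d; split; first by move: dL; rewrite mulSn; lia.
split; first by exists (0 * d); split; [| split; [exact: MP | exact: bw]].
move=> p pn; rewrite Bit_of_bits => /andP[_ /andP[/dvdnP[j ->]]].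
rewrite leq_pmul2r // leq_eqVlt => /orP[/eqP->|jt]; first by left; apply: bw.
right; exists (j.+1 * d); split; first by have := jL j.+1 jt; lia.
split; first by rewrite ltn_pmul2r.
split; first exact: MP.
apply/exsP; exists (v j); split; first by apply/small_bounded/sv/ltnW.
apply/exsP; exists (v j.+1); split; first by apply/small_bounded/sv.
by split; [apply/bw/ltnW | split; [apply: bw | apply: Rv]].
Qed.
End Completeness.

(** Equality in the base case admits runs shorter than [t ^ m]. It is spelled out by coordinates
    because [def_eq] compares single variables. *)
Fixpoint reach_iter (n : nat) (R : state -> state -> Prop) (m : nat) (s s' : state) : Prop :=
  if m is m'.+1 then reach n (reach_iter n R m') s s'
  else ((s.1.1 = s'.1.1 /\ (s.1.2 = s'.1.2 /\ s.2 = s'.2)) \/ R s s').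

Lemma reach_iter_invariant n R (I : state -> Prop) m :
  (forall x y, bounded n x -> bounded n y -> R x y -> I x -> I y) ->
  forall s s', bounded n s -> bounded n s' -> reach_iter n R m s s' -> I s -> I s'.
Proof.
move=> hI; elim: m => [|m IH] /=; last exact: reach_invariant.
move=> [[a b] u] [[a' b'] u'] bs bs' [/= [-> [-> ->]] //|]; exact: hI.
Qed.

Lemma reach_iter_path n L k t R m N (v : nat -> state) :
  2 ^ L <= n -> t.+1 * 2 ^ k <= L -> N <= t ^ m ->
  (forall j, j <= N -> small k (v j)) -> (forall j, j < N -> R (v j) (v j.+1)) ->
  reach_iter n R m (v 0) (v N).
Proof.
move=> Ln dL; elim: m N v => [|m IH] N v /= hN sv Rv.
  rewrite expn0 in hN; case: N hN sv Rv => [|[|//]] _ _ Rv; first by left.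
  by right; apply: Rv.
(* Checkpoints every [t ^ m] steps, cut off at [N], so the last stretches may be empty. *)
pose c j := minn (j * t ^ m) N.
have -> : v 0 = v (c 0) by rewrite /c mul0n min0n.
have -> : v N = v (c t) by rewrite /c -expnS; congr v; lia.
apply: (reach_path Ln dL (v := fun j => v (c j))) => j jt; first by apply: sv; rewrite geq_minr.
have le : c j <= c j.+1 by rewrite /c mulSn; lia.
have := IH (c j.+1 - c j) (fun i => v (c j + i)).
rewrite addn0 subnKC //; apply.
- by rewrite /c mulSn; lia.
- by move=> i hi; apply: sv; have := geq_minr (j.+1 * t ^ m) N; rewrite -/(c _); lia.
- by move=> i hi; rewrite addnS; apply: Rv; have := geq_minr (j.+1 * t ^ m) N; rewrite -/(c _); lia.
Qed.

(** Quantifying over all contexts lets definability of [R] pass under the quantifiers of [reach].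
    The parameters [p1], .., [p4] will be the [h], [e], [r], [x] of the multiplication. *)
Definition def_rel (S : finType) (sar : S -> nat)
    (R : nat -> state * nat -> state -> state -> Prop) : Prop :=
  forall T (N : T -> nat) vs p1 p2 p3 p4 a b u a' b' u',
    Var vs p1 -> Var vs p2 -> Var vs p3 -> Var vs p4 ->
    Var vs a -> Var vs b -> Var vs u -> Var vs a' -> Var vs b' -> Var vs u' ->
    def sar N vs (fun t => R (N t) (p1 t, p2 t, p3 t, p4 t) (a t, b t, u t) (a' t, b' t, u' t)).

Lemma def_reach (S : finType) (sar : S -> nat) R :
  def_rel sar R -> def_rel sar (fun n p => reach n (R n p)).
Proof.
move=> dR T N vs p1 p2 p3 p4 a b u a' b' u' *.
rewrite /reach /exs /block3 /block; cbn [fst snd].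
solve_def_lt ltac:(apply: dR; solve_var).
Qed.

Lemma def_reach_iter (S : finType) (sar : S -> nat) R m :
  def_rel sar R -> def_rel sar (fun n p => reach_iter n (R n p) m).
Proof.
move=> dR; elim: m => [|m IH]; last exact: (def_reach IH).
move=> T N vs p1 p2 p3 p4 a b u a' b' u' *; rewrite /=.
solve_def_lt ltac:(apply: dR; solve_var).
Qed.

(** * Multiplication *)

Lemma modn_sum_Bit h J : \sum_(0 <= p < J) Bit h p * 2 ^ p = h %% 2 ^ J.
Proof.
elim: J => [|J IH]; first by rewrite big_nil modn1.
by rewrite big_nat_recr //= IH modn_expS.
Qed.

(** * Column-wise long multiplication *)

Section LongMultiplication.
Variables (h e r x : nat).

(* sum of the terms 2^(p+q) h_p e_q with p + q < a + b, or p + q = a + b and p < a *)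
Definition partial_product (a b : nat) : nat :=
  \sum_(0 <= p < a) Bit h p * 2 ^ p * (e %% 2 ^ ((a + b).+1 - p)) +
  \sum_(a <= p < a + b) Bit h p * 2 ^ p * (e %% 2 ^ (a + b - p)).

(** A column is the set of digit products with [p + q] fixed. This adds the next product of a
    column; [partial_product_col] adds the last one and opens the next column. *)
Lemma partial_product_row a b :
  partial_product a.+1 b = partial_product a b.+1 + (Bit h a && Bit e b.+1) * 2 ^ (a + b.+1).
Proof.
have e1 : (a + b.+1).+1 - a = b.+2 by lia.
have e2 : a + b.+1 - a = b.+1 by lia.
have ab : a < a + b.+1 by lia.
rewrite /partial_product addSnnS big_nat_recr //= [in RHS](@big_ltn _ _ _ a) // e1 e2.
rewrite (modn_expS e b.+1) expnD -mulnb mulnDr; ring.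
Qed.

Lemma partial_product_col a :
  partial_product 0 a.+1 = partial_product a 0 + (Bit h a && Bit e 0) * 2 ^ a.
Proof.
rewrite /partial_product add0n !addn0 !(big_geq (leqnn _)) add0n addn0 big_nat_recr //=.
congr (_ + _); rewrite subSnn expn1 modn2 Bit0 -mulnb; lia.
Qed.

Lemma partial_product_full J B : h < 2 ^ B -> e < 2 ^ B -> B.*2 <= J ->
  partial_product 0 J = h * e.
Proof.
move=> hB eB BJ; rewrite /partial_product big_geq // !add0n.
have hJ : h = \sum_(0 <= p < J) Bit h p * 2 ^ p.
  by rewrite modn_sum_Bit modn_small //; apply: leq_trans hB _; rewrite leq_exp2l //; lia.
transitivity ((\sum_(0 <= p < J) Bit h p * 2 ^ p) * e); last by rewrite -hJ.
rewrite big_distrl /=; apply: eq_big_nat => p /andP[_ pJ].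
case b: (Bit h p) => //; congr (_ * _); rewrite modn_small //.
apply: leq_trans eB _; rewrite leq_exp2l //.
by have := Bit_lt_exp hB b; lia.
Qed.

(** The digit products left out are multiples of [2 ^ J]. *)
Lemma partial_product_mod J : partial_product 0 J = h * e %[mod 2 ^ J].
Proof.
rewrite -modnMml -[h %% _]modn_sum_Bit big_distrl /= /partial_product big_geq // !add0n.
rewrite -modn_summ -[RHS]modn_summ; congr (_ %% _); apply: eq_big_nat => p /andP[_ pJ].
rewrite -!mulnA muln_modr -expnD subnKC //; last exact: ltnW.
by rewrite modnMmr.
Qed.

(** The loop invariant: below column [a + b] the digits of [x] are already right, and [u] is what
    has accumulated in that column. *)
Definition mult_state (a b u : nat) : Prop :=
  partial_product a b + r %% 2 ^ (a + b) = x %% 2 ^ (a + b) + u * 2 ^ (a + b).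

(* [u] is the carry, in column [a + b], after the digit products with [p < a] *)
Definition mult_trans (s s' : state) : Prop :=
  let: (a, b, u) := s in let: (a', b', u') := s' in
  [/\ b = b'.+1, a' = a.+1 & u' = u + (Bit h a && Bit e b)] \/
  [/\ b = 0, a' = 0, b' = a.+1 &
      u + (Bit h a && Bit e 0) + Bit r a = u'.*2 + Bit x a].

(** The equation [x = h * e + r] is not assumed: closing a column checks a digit of [x], so an
    accepted run can prove the equation. *)
Lemma mult_trans_state a b u a' b' u' :
  mult_trans (a, b, u) (a', b', u') -> mult_state a b u -> mult_state a' b' u'.
Proof.
rewrite /mult_state => -[[-> -> ->]|[-> -> -> hu]].
  by rewrite partial_product_row addSnnS => h1; rewrite addnAC h1 mulnDl addnA.
rewrite addn0 add0n partial_product_col !modn_expS => h1.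
transitivity (x %% 2 ^ a + (u'.*2 + Bit x a) * 2 ^ a).
  by rewrite -hu !mulnDl; lia.
by rewrite expnS; lia.
Qed.

(** [x] does not occur: when the equation holds, the bit dropped by halving is the digit of [x]. *)
Definition mult_next (s : state) : state :=
  let: (a, b, u) := s in
  if b is b'.+1 then (a.+1, b', u + (Bit h a && Bit e b))
  else (0, a.+1, (u + (Bit h a && Bit e 0) + Bit r a)./2).

Lemma mult_next_trans a b u : x = h * e + r ->
  mult_state a b u -> mult_trans (a, b, u) (mult_next (a, b, u)).
Proof.
move=> xE; case: b => [|b]; rewrite /mult_state /=; last by left.
rewrite addn0 => h1; right; split=> //.
set v := _ + Bit r a; rewrite -[LHS]odd_double_half addnC; congr (_ + nat_of_bool _).
(* Modulo [2 ^ a.+1] the left side is [x], so the parity of [v] is digit [a] of [x]. *)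
have h2 : partial_product 0 a.+1 + r %% 2 ^ a.+1 = x %% 2 ^ a + v * 2 ^ a.
  by rewrite partial_product_col modn_expS /v !mulnDl; lia.
have := congr1 (fun y => y %% 2 ^ a.+1) h2; rewrite /= modnDmr -modnDml.
rewrite partial_product_mod modnDml -xE modn_expS.
have lt : x %% 2 ^ a < 2 ^ a by rewrite ltn_mod expn_gt0.
have -> : x %% 2 ^ a + v * 2 ^ a = v./2 * 2 ^ a.+1 + (x %% 2 ^ a + odd v * 2 ^ a).
  by rewrite expnS -{1}[v]odd_double_half -mul2n; ring.
rewrite modnMDl (@modn_small (_ + _)); last by rewrite expnS; case: (odd v); lia.
by case: (odd v) (Bit x a) => [] []; lia.
Qed.

Definition mult_run (j : nat) : state := iter j mult_next (0, 0, 0).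

Lemma mult_run_state : x = h * e + r ->
  forall j, mult_state (mult_run j).1.1 (mult_run j).1.2 (mult_run j).2.
Proof.
move=> xE; elim=> [|j IH] /=.
  by rewrite /mult_state /partial_product /= !big_geq //= !modn1.
case: (mult_run j) IH => [[a b] u] IH; have := mult_next_trans xE IH.
by case: (mult_next _) => [[a' b'] u'] /mult_trans_state; apply.
Qed.

Lemma mult_run_trans : x = h * e + r ->
  forall j, mult_trans (mult_run j) (mult_run j.+1).
Proof.
move=> xE j; have := mult_run_state xE j; rewrite /=.
by case: (mult_run j) => [[a b] u] /(mult_next_trans xE).
Qed.

Lemma mult_run_bound j :
  (mult_run j).1.1 + (mult_run j).1.2 <= j /\ (mult_run j).2 <= j.*2.
Proof.
elim: j => //= j; case: (mult_run j) => [[a [|b]] u] /= [h1 h2]; last first.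
  by case: (Bit _ _ && _); lia.
split; first by lia.
by case: (Bit _ _ && _) (Bit r a) => [] []; lia.
Qed.

Lemma mult_run_row j c a b u : mult_run j = (a, b + c, u) ->
  exists u', mult_run (j + c) = (a + c, b, u').
Proof.
elim: c j a u => [|c IH] j a u hj; first by exists u; rewrite !addn0 in hj *.
have [|u' hu'] := IH j.+1 a.+1 (u + (Bit h a && Bit e (b + c).+1)).
  by rewrite /= hj addnS.
by exists u'; rewrite -addSnnS hu' addSnnS.
Qed.

(** Column [i] takes [i + 1] steps, so the bound is generous. *)
Lemma mult_run_reaches J : exists j u, j <= J * J.+1 /\ mult_run j = (0, J, u).
Proof.
elim: J => [|J [j [u [hj e1]]]]; first by exists 0, 0.
have [u' e2] := @mult_run_row j J 0 0 u e1.
exists (j + J).+1; rewrite /= e2 /=; eexists; split; last by rewrite add0n.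
by rewrite !mulSn !mulnS; move: hj; rewrite mulnS; lia.
Qed.

End LongMultiplication.

(** * Multiplication as a formula *)

Definition incr (c : Prop) (u v : nat) : Prop := (c /\ is_succ u v) \/ (~ c /\ v = u).

Definition halve (n v u : nat) : Prop :=
  allb n (fun k => allb n (fun k' => is_succ k k' -> (Bit v k' <-> Bit u k))).

Definition is_zero (n z : nat) : Prop := allb n (fun y => ~ y < z).

(** The first-order form of [mult_trans], with [p] holding [(h, e, r, x)]. In the second alternative
    [s.1.2] is zero, so [Bit w s.1.2] is the parity of the column sum [w]. *)
Definition mult_step (n : nat) (p : state * nat) (s s' : state) : Prop :=
  ((is_succ s'.1.2 s.1.2 /\ is_succ s.1.1 s'.1.1) /\
    incr (Bit p.1.1.1 s.1.1 /\ Bit p.1.1.2 s.1.2) s.2 s'.2) \/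
  ((is_zero n s.1.2 /\ (is_zero n s'.1.1 /\ is_succ s.1.1 s'.1.2)) /\
    exb n (fun v => exb n (fun w => (incr (Bit p.1.1.1 s.1.1 /\ Bit p.1.1.2 s.1.2) s.2 v /\
      incr (Bit p.1.2 s.1.1) v w) /\
      ((Bit w s.1.2 <-> Bit p.2 s.1.1) /\ halve n w s'.2)))).

Lemma def_mult_step (S : finType) (sar : S -> nat) : def_rel sar mult_step.
Proof.
move=> T N vs p1 p2 p3 p4 a b u a' b' u' *.
rewrite /mult_step /incr /halve /is_zero; cbn [fst snd].
solve_def_lt ltac:(apply: def_succ; solve_var).
Qed.

Lemma is_zeroP n z : z <= n -> is_zero n z <-> z = 0.
Proof.
move=> zn; split=> [h|-> //]; case: z zn h => // z zn h.
by case: (h 0).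
Qed.

Lemma incrP (c : bool) u v : incr c u v <-> v = u + c.
Proof. by rewrite /incr /is_succ; case: c; split; intuition lia. Qed.

Lemma halveP n v u : v <= n -> u <= n -> halve n v u <-> v./2 = u.
Proof.
move=> vn un; split=> [h|<- k kn k' kn' ->]; last by rewrite BitS.
apply: (@Bit_inj_le n) => //; first by lia.
(* The formula says nothing about position [n] of [u], but elements of the universe have no digit
   there. *)
move=> i; rewrite -BitS leq_eqVlt => /orP[/eqP->|ni].
  by apply/idP/idP => /Bit_ltn; lia.
by have hi := h i (ltnW ni) i.+1 ni erefl; apply/idP/idP => /hi.
Qed.

Lemma mult_step_sound n h e r x s s' : bounded n s -> bounded n s' ->
  mult_step n (h, e, r, x) s s' -> mult_trans h e r x s s'.
Proof.
case: s s' => [[a b] u] [[a' b'] u'] [/= an bn un] [/= an' bn' un'].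
have cP (c d : bool) y z : incr (c /\ d) y z -> z = y + (c && d).
  by move=> H; apply/incrP; move: H; rewrite /incr; case: c d => [] []; intuition.
case=> /= [[[-> ->] /cP ->]|[[/(is_zeroP bn) -> [/(is_zeroP an') -> ->]]]]; first by left.
case=> v [vn [w [wn [[/cP hv /incrP hw] [h1 /halveP h2]]]]].
right; split=> //; rewrite -hv -hw -h2 // -(_ : odd w = Bit x a); last first.
  by rewrite -Bit0; apply/idP/idP => /h1.
by rewrite addnC odd_double_half.
Qed.

(** The hypothesis [s.2.+2 <= n] leaves room for the two increments before the halving. *)
Lemma mult_step_complete n h e r x s s' : bounded n s -> bounded n s' -> s.2.+2 <= n ->
  mult_trans h e r x s s' -> mult_step n (h, e, r, x) s s'.
Proof.
case: s s' => [[a b] u] [[a' b'] u'] [/= an bn un] [/= an' bn' un'] un2.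
have cP (c d : bool) y : incr (c /\ d) y (y + (c && d)).
  have /incrP : y + (c && d) = y + (c && d) by [].
  by rewrite /incr; case: c d => [] []; intuition.
case=> [[-> -> ->]|[-> -> -> hu]]; first by left; split.
right; split; first by split=> /=; [exact/is_zeroP | split; first exact/is_zeroP].
have [vn wn] : u + (Bit h a && Bit e 0) <= n /\ u + (Bit h a && Bit e 0) + Bit r a <= n.
  by clear -un2; case: (Bit h a && _) (Bit r a) => [] []; split; lia.
exists (u + (Bit h a && Bit e 0)); split=> //.
exists (u + (Bit h a && Bit e 0) + Bit r a); split=> //.
split; first by split=> /=; [exact: cP | exact/incrP].
rewrite hu in wn *; split=> /=; first by rewrite Bit0 addnC oddD odd_double addbF oddb.
by apply/halveP => //; rewrite addnC half_bit_double.
Qed.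

Lemma Bit_trunc_log y : 0 < y -> Bit y (trunc_log 2 y).
Proof.
move=> y0; have [] := andP (trunc_log_bounds (isT : 1 < 2) y0).
rewrite expnS /Bit; set d := 2 ^ _ => h1 h2.
have -> // : y %/ d = 1.
by apply/eqP; rewrite eqn_leq -ltnS ltn_divLR ?divn_gt0 ?expn_gt0 // h2 h1.
Qed.

(** [K] bounds the digit positions of all elements and [J] is [2 K] or [2 K + 1], so no digit
    product lies in column [J] or beyond. Ending there with carry zero certifies the equation. *)
Definition muladd (n h e r x : nat) : Prop :=
  exb n (fun z => exb n (fun J => exb n (fun K =>
    ((is_zero n z /\ halve n J K) /\
      allb n (fun y => allb n (fun p => Bit y p -> p < K))) /\
    reach_iter n (mult_step n (h, e, r, x)) 8 (z, z, z) (z, J, z)))).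

Lemma def_muladd (S : finType) (sar : S -> nat) T (N : T -> nat) vs h e r x :
  Var vs h -> Var vs e -> Var vs r -> Var vs x ->
  def sar N vs (fun t => muladd (N t) (h t) (e t) (r t) (x t)).
Proof.
move=> *; rewrite /muladd /is_zero /halve.
solve_def_lt ltac:(idtac; first [apply: def_succ; solve_var
  | apply: (def_reach_iter 8 (@def_mult_step S sar)); solve_var]).
Qed.

Lemma muladd_sound n h e r x : h <= n -> e <= n -> r <= n -> x <= n ->
  muladd n h e r x -> x = h * e + r.
Proof.
move=> hn en rn xn [z [zn [J [Jn [K [Kn [[[hz hJ] hK] hr]]]]]]].
have {hz} z0 : z = 0 by apply/(is_zeroP zn).
have {}hJ : J./2 = K by apply/(halveP Jn Kn).
subst z; have small y : y <= n -> y < 2 ^ K.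
  move=> yn; have [->|y0] := posnP y; first exact: expn_gt0.
  have [_ yl] := andP (trunc_log_bounds (isT : 1 < 2) y0).
  apply: (leq_trans yl); rewrite leq_exp2l //.
  have yb := Bit_trunc_log y0; apply: (hK y yn) => //.
  by have := Bit_ltn yb; lia.
have inv0 : mult_state h e r x 0 0 0.
  by rewrite /mult_state /partial_product !big_geq //= !modn1.
have b0 : bounded n (0, 0, 0) by [].
have bJ : bounded n (0, J, 0) by [].
pose I (s : state) := mult_state h e r x s.1.1 s.1.2 s.2.
have hI s s' : bounded n s -> bounded n s' -> mult_step n (h, e, r, x) s s' -> I s -> I s'.
  case: s s' => [[a b] u] [[a' b'] u'] bs bs' /(mult_step_sound bs bs').
  exact: mult_trans_state.
have := reach_iter_invariant hI b0 bJ hr inv0; rewrite /I /=.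
rewrite /mult_state add0n mul0n addn0 (@partial_product_full _ _ J K); try exact: small.
  have lt y : y <= n -> y < 2 ^ J.
    by move=> /small yK; apply: leq_trans yK _; rewrite leq_exp2l //; lia.
  by rewrite !modn_small ?lt.
by lia.
Qed.

(** With [L] the logarithm of [n], both the number of states and the block length are [2 ^ k], of
    the order of the square root of [L]: together they fit into [L] bits. Eightfold nesting then
    gives about [L ^ 4] steps, against order [L ^ 2] needed. *)
Lemma muladd_sizes : exists N0, forall n, N0 <= n -> exists L k t,
  [/\ 2 ^ L <= n, n < 2 ^ L.+1, t.+1 * 2 ^ k <= L,
      L.+1.*2 * L.+1.*2.+1 <= t ^ 8 & (L.+1.*2 * L.+1.*2.+1).*2.+2 <= 2 ^ 2 ^ k].
Proof.
(* keeps [2 ^ 2 ^ 20] from being computed *)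
have [c c10] : exists c, 10 <= c by exists 10.
exists (2 ^ 2 ^ c.*2) => n nN.
have n0 : 0 < n by apply: leq_trans nN; rewrite expn_gt0.
have [h1 h2] := andP (trunc_log_bounds (isT : 1 < 2) n0).
set L := trunc_log 2 n in h1 h2.
have L0 : 2 ^ c.*2 <= L by apply: trunc_log_max.
have L1 : 0 < L by apply: leq_trans L0; rewrite expn_gt0.
have [l1 l2] := andP (trunc_log_bounds (isT : 1 < 2) L1).
set l := trunc_log 2 L in l1 l2.
have l0 : c.*2 <= l by apply: trunc_log_max.
pose g := l./2; have g0 : 10 <= g by rewrite /g; lia.
have gL : 2 ^ g.*2 <= L by apply: leq_trans l1; rewrite leq_exp2l // /g; lia.
have gL2 : L < 2 ^ g.*2.+2 by apply: leq_trans l2 _; rewrite leq_exp2l // /g; lia.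
exists L, g, (2 ^ g).-1; rewrite prednK ?expn_gt0 //.
have bnd : L.+1.*2 * L.+1.*2.+1 <= 2 ^ (4 * g + 7).
  have -> : 2 ^ (4 * g + 7) = 2 ^ g.*2.+3 * 2 ^ g.*2.+4 by rewrite -expnD; congr (_ ^ _); lia.
  by apply: leq_mul; rewrite [2 ^ _.+3]expnS ?[2 ^ _.+4]expnS ?[2 ^ _.+3]expnS; lia.
split=> //.
- by rewrite -expnD addnn.
- apply: leq_trans bnd _; apply: (@leq_trans ((2 ^ g.-1) ^ 8)).
    by rewrite -expnM leq_exp2l //; lia.
  rewrite leq_exp2r //; have -> : 2 ^ g = 2 * 2 ^ g.-1 by rewrite -expnS prednK //; lia.
  by have := expn_gt0 2 g.-1; lia.
- have gg : 4 * g + 9 <= 2 ^ g.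
    elim: g g0 {gL gL2 bnd} => // g IH; rewrite leq_eqVlt => /orP[/eqP<-|/IH]; first by [].
    by rewrite expnS; lia.
  apply: (@leq_trans (2 ^ (4 * g + 9))); last by rewrite leq_exp2l.
  rewrite !addnS !expnS in bnd *; lia.
Qed.

Lemma muladdP : exists N0, forall n h e r x, N0 <= n ->
  h <= n -> e <= n -> r <= n -> x <= n -> (muladd n h e r x <-> x = h * e + r).
Proof.
have [N0 sizes] := muladd_sizes; exists N0 => n h e r x nN hn en rn xn.
split=> [|xE]; first exact: muladd_sound.
have [L [k [t [Ln nL tL Nt Nk]]]] := sizes n nN.
set J := L.+1.*2 in Nt Nk.
have kn : 2 ^ 2 ^ k <= n.
  by apply: leq_trans Ln; rewrite leq_exp2l //; move: tL; rewrite mulSn; lia.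
have JJ : J <= J * J.+1 by rewrite mulnS leq_addr.
have [j [u [hj run]]] := mult_run_reaches h e r J.
have LJ : L.+1 <= J by rewrite /J; lia.
(* By the invariant, [u * 2 ^ J] is the difference of [h * e + r] and [x]. *)
have u0 : u = 0.
  have := mult_run_state xE j; rewrite run /mult_state /= add0n.
  have lt y : y <= n -> y < 2 ^ J.
    by move=> yn; apply: (@leq_trans (2 ^ L.+1)); [lia | rewrite leq_exp2l].
  rewrite (@partial_product_full _ _ J L.+1) ?modn_small ?lt //; try lia.
exists 0; split=> //; exists J; split; first by lia.
exists L.+1; split; first by lia.
split; first split; first split.
- exact/is_zeroP.
- by apply/halveP; rewrite ?/J ?doubleK //; lia.
- by move=> y yn p _; apply: Bit_lt_exp; lia.
have sm i : i <= j -> small k (mult_run h e r i).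
  by move=> ij; have [h1 h2] := mult_run_bound h e r i; split; lia.
have bd i : i <= j -> bounded n (mult_run h e r i).
  by move=> /sm [? ? ?]; split; lia.
rewrite u0 in run; rewrite -run.
apply: (reach_iter_path (v := mult_run h e r) Ln tL (leq_trans hj Nt) sm).
move=> i ij; apply: mult_step_complete; try by apply: bd; lia.
  by have [h1 h2] := mult_run_bound h e r i; lia.
exact: mult_run_trans.
Qed.

(** * The triangular order *)

Lemma qtriS i : qtri i.+1 = qtri i + i.+1.
Proof.
rewrite /qtri; have -> : i.+1 * i.+2 = i.+1 * 2 + i * i.+1 by ring.
by rewrite divnMDl // addnC.
Qed.

Lemma qtri_mono i j : i <= j -> qtri i <= qtri j.
Proof.
elim: j => [|j IH]; first by rewrite leqn0 => /eqP->.
rewrite leq_eqVlt => /orP[/eqP->//|/IH h]; rewrite qtriS; lia.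
Qed.

Lemma qtri_ge i : i <= qtri i.
Proof. by elim: i => // i IH; rewrite qtriS leq_addl. Qed.

(** Halving the even factor gives a product without division, to which [muladd] applies. *)
Lemma qtri_half c : qtri c = (if odd c then c./2.+1 * c else c./2 * c.+1).
Proof.
elim: c => // c IH; rewrite qtriS IH /=; have := odd_double_half c.
rewrite uphalf_half; move: (odd c) (c./2) => b k <- {c IH}.
by case: b => /=; rewrite -mul2n; ring.
Qed.

Lemma ctri_unique x c r : r <= c -> x = qtri c + r -> ctri x = c.
Proof.
move=> rc xE; apply/eqP; rewrite eqn_leq; apply/andP; split.
  apply/bigmax_leqP => i ix; case: leqP => // ci.
  by have := qtri_mono ci; rewrite qtriS; lia.
have cx : c < x.+1 by have := qtri_ge c; lia.
by apply: (@leq_bigmax_cond _ _ _ (Ordinal cx)); rewrite /= xE leq_addr.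
Qed.

Lemma ctri_exists x : exists c, qtri c <= x < qtri c.+1.
Proof.
elim: x => [|x [c /andP[h1 h2]]]; first by exists 0.
have [h|h] := ltnP x.+1 (qtri c.+1); first by exists c; rewrite h leqW.
by exists c.+1; rewrite h qtriS; lia.
Qed.

Lemma ctri_rtri x : rtri x <= ctri x /\ x = qtri (ctri x) + rtri x.
Proof.
have [c /andP[h1 h2]] := ctri_exists x; rewrite qtriS in h2.
rewrite /rtri (@ctri_unique x c (x - qtri c)); lia.
Qed.

(** As [z] is zero, [Bit c z] is the parity of [c], and [h * e] is [qtri c] by [qtri_half]. *)
Definition tri_coord (n x c r : nat) : Prop :=
  exb n (fun z => exb n (fun g => exb n (fun h => exb n (fun e =>
    (is_zero n z /\ (halve n c g /\ ~ c < r)) /\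
    (((~ Bit c z /\ (is_succ c e /\ h = g)) \/ (Bit c z /\ (e = c /\ is_succ g h))) /\
     muladd n h e r x))))).

Definition tri_fo (n x y : nat) : Prop :=
  exb n (fun c => exb n (fun r => exb n (fun c' => exb n (fun r' =>
    (tri_coord n x c r /\ tri_coord n y c' r') /\
    (r < r' \/ (r = r' /\ c < c')))))).

Lemma tri_coordP : exists N0, forall n x c r, N0 <= n -> x <= n -> c <= n -> r <= n ->
  (tri_coord n x c r <-> c = ctri x /\ r = rtri x).
Proof.
have [N0 mP] := muladdP; exists (N0 + 3) => n x c r nN xn cn rn.
have nN0 : N0 <= n by lia.
have uniq : (r <= c /\ x = qtri c + r) <-> (c = ctri x /\ r = rtri x).
  split=> [[rc xE]|[-> ->]]; last exact: ctri_rtri.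
  have cE := ctri_unique rc xE; split; first by rewrite cE.
  by rewrite /rtri cE xE addKn.
rewrite -uniq qtri_half; split.
  move=> [z [zn [g [gn [h [hn [e [en [[hz [hg rc]] [hc hx]]]]]]]]]].
  have {hz} zE := (is_zeroP zn).1 hz; subst z.
  have {hg} gE := (halveP cn gn).1 hg; subst g.
  have {hx} xE := (mP n h e r x nN0 hn en rn xn).1 hx.
  split; first by lia.
  move: hc; rewrite Bit0 xE; case: (odd c) => -[[// _ [-> ->]]|[// _ [-> ->]]] //.
(* For even [c] the factor [c.+1] must lie in the universe. This holds for [c <= 2] because
   [3 <= n], and otherwise because [c < qtri c <= x]. *)
case=> rc xE; have hc : c.+1 <= n.
  have : qtri c <= n by rewrite qtri_half; lia.
  by case: c {uniq rc xE} cn => [|[|[|c]]]; rewrite ?qtriS; lia.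
exists 0; split=> //; exists c./2; split; first by lia.
exists (if odd c then c./2.+1 else c./2); split; first by case: ifP; lia.
exists (if odd c then c else c.+1); split; first by case: ifP; lia.
split; first split; first exact/is_zeroP.
  by split; [apply/halveP => //; lia | lia].
split; first by rewrite Bit0; case: (odd c); [right | left].
apply/mP => //; [by case: ifP; lia | by case: ifP; lia |].
by rewrite {1}xE; case: ifP.
Qed.

Lemma tri_foP : exists N0, forall n x y, N0 <= n -> x <= n -> y <= n ->
  (tri_fo n x y <-> tri x y).
Proof.
have [N0 cP] := tri_coordP; exists N0 => n x y nN xn yn; rewrite /tri.
have bd z : z <= n -> ctri z <= n /\ rtri z <= n.
  by have [h1 h2] := ctri_rtri z; have := qtri_ge (ctri z); lia.
split.
  move=> [c [cn [r [rn [c' [cn' [r' [rn' [[h1 h2] h3]]]]]]]]].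
  have [<- <-] := (cP n x c r nN xn cn rn).1 h1.
  have [<- <-] := (cP n y c' r' nN yn cn' rn').1 h2.
  by case: h3 => [-> //|[-> ->]]; rewrite eqxx orbT.
move=> h; have [cx rx] := bd x xn; have [cy ry] := bd y yn.
exists (ctri x); split=> //; exists (rtri x); split=> //.
exists (ctri y); split=> //; exists (rtri y); split=> //.
split; first by split; apply/cP.
by case/orP: h => [->|/andP[/eqP-> ->]]; [left | right].
Qed.

(** * Small universes and translation of formulas *)

Section Definability.
Variables (S : finType) (sar : S -> nat).

(** Constants serve to tabulate [tri] on universes below the threshold of [tri_foP]. *)
Lemma def_const p T (N : T -> nat) vs f : Var vs f -> def sar N vs (fun t => f t = p).
Proof.
elim: p T N vs f => [|p IH] T N vs f vf.
  apply: (@def_ext _ _ _ _ _ (fun t => is_zero (N t) (f t))).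
    by move=> t b; apply/is_zeroP/b.
  by rewrite /is_zero; solve_def_lt idtac.
apply: (@def_ext _ _ _ _ _ (fun t => exb (N t) (fun y => (y = p) /\ is_succ y (f t)))).
  move=> t b; split=> [[y [yn [-> ->]]] //|e].
  by exists p; split=> //; have := b _ vf; rewrite e; apply: ltnW.
apply: def_exb; apply: def_and; first by apply: IH; solve_var.
by apply: def_succ; solve_var.
Qed.

Lemma def_size_lt p T (N : T -> nat) vs : def sar N vs (fun t => N t < p).
Proof.
apply: (@def_ext _ _ _ _ _ (fun t => ~ exb (N t) (fun y => y = p))).
  move=> t _; split=> [h|h [y [yn e]]]; last by lia.
  by rewrite ltnNge; apply/negP => pn; apply: h; exists p.
by apply: def_not; apply: def_exb; apply: def_const; solve_var.
Qed.

Lemma def_table (s : seq (nat * nat)) T (N : T -> nat) vs f g :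
  Var vs f -> Var vs g -> def sar N vs (fun t => (f t, g t) \in s).
Proof.
move=> vf vg; elim: s => [|[p q] s IH].
  apply: (@def_ext _ _ _ _ _ (fun t => f t < f t)); first by move=> t _; rewrite ltnn in_nil.
  exact: def_lt.
apply: (@def_ext _ _ _ _ _ (fun t => (f t = p /\ g t = q) \/ (f t, g t) \in s)).
  move=> t _; rewrite inE xpair_eqE; split.
    by case=> [[-> ->]|->]; rewrite ?eqxx ?orbT.
  by case/orP => [/andP[/eqP-> /eqP->]|->]; [left | right].
by apply: def_or => //; apply: def_and; apply: def_const.
Qed.

Lemma def_tri T (N : T -> nat) vs f g :
  Var vs f -> Var vs g -> def sar N vs (fun t => tri (f t) (g t)).
Proof.
move=> vf vg; have [N0 fP] := tri_foP.
pose s := [seq p <- [seq (x, y) | x <- iota 0 N0, y <- iota 0 N0] | tri p.1 p.2].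
apply: (@def_ext _ _ _ _ _ (fun t => (N t < N0 /\ (f t, g t) \in s) \/
    (~ N t < N0 /\ tri_fo (N t) (f t) (g t)))).
  move=> t b; have fn := b _ vf; have gn := b _ vg.
  have [small|large] := ltnP (N t) N0; last first.
    rewrite fP //; split=> [[[]//|[]//]|h]; by right.
  rewrite mem_filter /= (_ : (f t, g t) \in _).
    by rewrite andbT; split=> [[[]//|[] /(_ isT)//]|h]; left.
  by apply/allpairsP; exists (f t, g t); rewrite !mem_iota /=; split=> //; lia.
apply: def_or; apply: def_and; try exact: def_table; try exact: def_size_lt.
  by apply: def_not; apply: def_size_lt.
rewrite /tri_fo /tri_coord /is_zero /halve.
solve_def_lt ltac:(idtac; first [apply: def_succ; solve_var | apply: def_muladd; solve_var]).
Qed.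

Lemma def_var2 (P : nat -> nat -> Prop) :
  (forall T (N : T -> nat) vs f g, Var vs f -> Var vs g ->
    def sar N vs (fun t => P (f t) (g t))) ->
  forall x y : nat, exists g : FO_bit sar, forall n I a, (forall z, a z <= n) ->
    (sat bit_int n I a g <-> P (a x) (a y)).
Proof.
(* The context consists of the universe size and the assignment. *)
move=> hP x y; pose vs := [:: fun t : nat * (nat -> nat) => t.2 x; fun t => t.2 y].
have [||g hg] := hP _ fst vs (fun t => t.2 x) (fun t => t.2 y) _ _ [:: x; y] erefl.
- by exists 0.
- by exists 1.
by exists g => n I a an; apply: (hg (n, a)).
Qed.

Lemma FO_lt_tri_bit (f : FO_lt_tri sar) :
  exists g : FO_bit sar, equiv_fo ltTri_int bit_int f g.
Proof.
have sat2 (b : LtTriSym) xs n I a (an : forall z, a z <= n) :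
    sat ltTri_int n I a (@FBi S sar _ ltTri_ar b xs) <->
    (if b is SymLt then a (xs ord0) < a (xs (lift ord0 ord0))
     else tri (a (xs ord0)) (a (xs (lift ord0 ord0)))).
  by rewrite /= /ltTri_ar !enum_ordSl enum_ord0 /= !an; case: b xs => xs; split=> // -[].
elim: f => [x y|s xs|[] xs|f [g hg]|f [g hg] f' [g' hg']|x f [g hg]].
- by exists (FEq _ _ x y).
- by exists (FRel _ xs).
- have [g hg] := @def_var2 (fun i j => i < j) (@def_lt S sar) (xs ord0) (xs (lift ord0 ord0)).
  by exists g => n I a an; rewrite (sat2 SymLt) // hg.
- have [g hg] := @def_var2 (fun i j => tri i j) def_tri (xs ord0) (xs (lift ord0 ord0)).
  by exists g => n I a an; rewrite (sat2 SymTri) // hg.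
- by exists (FNot g) => n I a an /=; rewrite hg.
- by exists (FAnd g g') => n I a an /=; rewrite hg // hg'.
- exists (FEx x g) => n I a an /=.
  by split=> -[v [vn hv]]; exists v; split=> //; apply/hg => // z; rewrite /upd; case: ifP.
Qed.
End Definability.

(** * Inexpressibility of parity *)

(** The usual invariant of the Ehrenfeucht game on linear orders. Since [p] and [q] may be
    exchanged, truncated subtraction records both the order and the distance up to [2 ^ k]. *)
Definition similar (k : nat) (Z : seq (nat * nat)) : Prop :=
  forall p q, p \in Z -> q \in Z -> minn (p.1 - q.1) (2 ^ k) = minn (p.2 - q.2) (2 ^ k).

Lemma similar_le j k Z : j <= k -> similar k Z -> similar j Z.
Proof.
move=> jk h p q pZ qZ; have := h p q pZ qZ.
have : 2 ^ j <= 2 ^ k by rewrite leq_exp2l.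
by lia.
Qed.

Lemma similar_lt k Z p q : similar k Z -> p \in Z -> q \in Z -> (p.1 < q.1) = (p.2 < q.2).
Proof. by move=> h pZ qZ; have := h q p qZ pZ; have := expn_gt0 2 k; lia. Qed.

Lemma similar_eq k Z p q : similar k Z -> p \in Z -> q \in Z -> p.1 = q.1 <-> p.2 = q.2.
Proof.
move=> h pZ qZ; have := h q p qZ pZ; have := h p q pZ qZ.
by have := expn_gt0 2 k; lia.
Qed.

(** Exchanging the two sides reduces both directions of the game to one. *)
Definition swap (Z : seq (nat * nat)) : seq (nat * nat) := [seq (p.2, p.1) | p <- Z].

Lemma mem_swap Z p : (p.2, p.1) \in swap Z = (p \in Z).
Proof. by case: p => x y; apply: (mem_map (f := fun p => (p.2, p.1))) => -[? ?] [? ?] [-> ->]. Qed.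

Lemma similar_swap k Z : similar k Z -> similar k (swap Z).
Proof. by move=> h _ _ /mapP[p pZ ->] /mapP[q qZ ->] /=; rewrite h. Qed.

Lemma minn_add K x x' y y' : minn x K = minn x' K -> minn y K = minn y' K ->
  minn (x + y) K = minn (x' + y') K.
Proof. lia. Qed.

Lemma minn_sub0 K x y x' y' : 0 < K -> minn (x - y) K = minn (x' - y') K -> x <= y -> x' <= y'.
Proof. lia. Qed.

(** Distances to the nearest matched point determine those to all points beyond it, up to the
    threshold. *)
Lemma minn_sub_trans K x y z x' y' z' : 0 < K -> x <= y -> y <= z -> y' <= z' ->
  minn (z - y) K = minn (z' - y') K ->
  minn (x - y) K = minn (x' - y') K -> minn (y - x) K = minn (y' - x') K ->
  minn (z - x) K = minn (z' - x') K /\ minn (x - z) K = minn (x' - z') K.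
Proof.
move=> K0 xy yz yz' h1 /(minn_sub0 K0)/(_ xy) xy' h2.
have -> : z - x = z - y + (y - x) by lia.
have -> : z' - x' = z' - y' + (y' - x') by lia.
split; first exact: minn_add.
by rewrite (eqP (leq_trans xy yz)) (eqP (leq_trans xy' yz')).
Qed.

(** Between the nearest matched points [a <= p <= b], the answer copies the distance to whichever of
    them is closer than [2 ^ k]. Splitting the gap is what halves the threshold. *)
Lemma similar_extend k Z C p : similar k.+1 Z -> (0, 0) \in Z -> (C, C) \in Z -> p <= C ->
  exists2 p', p' <= C & similar k ((p, p') :: Z).
Proof.
move=> sZ Z0 ZC pC.
have [[a a'] /= aZ [ap amax]] : exists2 a, a \in Z &
    a.1 <= p /\ forall q, q \in Z -> q.1 <= p -> q.1 <= a.1.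
  have ex : exists i, (i <= p) && has (fun q => q.1 == i) Z.
    by exists 0; apply/hasP; exists (0, 0).
  have ub i : (i <= p) && has (fun q => q.1 == i) Z -> i <= p by case/andP.
  case: (ex_maxnP ex ub) => i /andP[ip /hasP[a aZ /eqP ai]] imax.
  exists a => //; rewrite ai; split=> // q qZ qp; apply: imax.
  by rewrite qp; apply/hasP; exists q.
have [[b b'] /= bZ [bp bmin]] : exists2 b, b \in Z &
    p <= b.1 /\ forall q, q \in Z -> p <= q.1 -> b.1 <= q.1.
  have ex : exists i, (p <= i) && has (fun q => q.1 == i) Z.
    by exists C; rewrite pC; apply/hasP; exists (C, C).
  case: (ex_minnP ex) => i /andP[ip /hasP[b bZ /eqP bi]] imin.
  exists b => //; rewrite bi; split=> // q qZ qp; apply: imin.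
  by rewrite qp; apply/hasP; exists q.
have bC : b <= C by exact: bmin _ ZC pC.
have [K K0 KE] : exists2 K, 0 < K & K = 2 ^ k by exists (2 ^ k); rewrite // expn_gt0.
have sZk : similar k Z by apply: similar_le sZ.
have sZK u v : u \in Z -> v \in Z -> minn (u.1 - v.1) K = minn (u.2 - v.2) K.
  by rewrite KE; apply: sZk.
have b'C : b' <= C by exact: minn_sub0 K0 (sZK _ _ bZ ZC) bC.
have ab' : a' <= b' by exact: minn_sub0 K0 (sZK _ _ aZ bZ) (leq_trans ap bp).
have ab : minn (b - a) (2 * K) = minn (b' - a') (2 * K).
  by rewrite KE -expnS; apply: (sZ _ _ bZ aZ).
have [p' [a'p' p'b' pa bp']] : exists p', [/\ a' <= p', p' <= b',
    minn (p - a) K = minn (p' - a') K & minn (b - p) K = minn (b' - p') K].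
  case: (ltnP (p - a) K) => h1; first by exists (a' + (p - a)); split; lia.
  case: (ltnP (b - p) K) => h2; first by exists (b' - (b - p)); split; lia.
  (* Both parts are at least [K], so [b - a] and hence [b' - a'] are at least [2 * K]. *)
  by exists (a' + K); split; lia.
exists p'; first exact: leq_trans b'C.
have key q : q \in Z -> minn (p - q.1) K = minn (p' - q.2) K /\
                        minn (q.1 - p) K = minn (q.2 - p') K.
  move=> qZ; case: (leqP q.1 p) => qp.
    exact: minn_sub_trans K0 (amax q qZ qp) ap a'p' pa (sZK _ _ qZ aZ) (sZK _ _ aZ qZ).
  have qb := bmin q qZ (ltnW qp).
  have b'q' : b' <= q.2 by exact: minn_sub0 K0 (sZK _ _ bZ qZ) qb.
  have pb : minn (p - b) K = minn (p' - b') K by rewrite (eqP bp) (eqP p'b').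
  have [h1 h2] := minn_sub_trans K0 bp qb b'q' (sZK _ _ qZ bZ) pb bp'.
  by split.
move=> q r; rewrite !inE => /orP[/eqP->|qZ] /orP[/eqP->|rZ] /=; rewrite -?KE.
- by rewrite !subnn.
- exact: (key r rZ).1.
- exact: (key q qZ).2.
- by rewrite KE; apply: sZk.
Qed.

(* a move on the triangle is two moves on its coordinates *)
Fixpoint rank S sar B bar (f : @form S sar B bar) : nat :=
  match f with
  | FEq _ _ | FRel _ _ | FBi _ _ => 0
  | FNot g => rank g
  | FAnd g h => maxn (rank g) (rank h)
  | FEx _ g => (rank g).+2
  end.

Lemma qtri_lt_row c r c' r' : r <= c -> r' <= c' ->
  (qtri c + r < qtri c' + r') = (c < c') || (c == c') && (r < r').
Proof.
move=> rc rc'; case: (ltngtP c c') => [h|h|->] /=; last by rewrite ltn_add2l.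
  by have := qtri_mono h; rewrite qtriS; lia.
by have := qtri_mono h; rewrite qtriS; lia.
Qed.

(** Thus [<] compares [ctri] first and [tri] compares [rtri] first: both orders are lexicographic in
    the same coordinates. *)
Lemma ltn_ctri x y :
  (x < y) = (ctri x < ctri y) || (ctri x == ctri y) && (rtri x < rtri y).
Proof.
have [hx ex] := ctri_rtri x; have [hy ey] := ctri_rtri y.
by rewrite {1}ex {1}ey qtri_lt_row.
Qed.

Lemma eq_ctri x y : x = y <-> ctri x = ctri y /\ rtri x = rtri y.
Proof.
split=> [-> //|[hc hr]].
by have [_ ->] := ctri_rtri x; rewrite hc hr; have [_ <-] := ctri_rtri y.
Qed.

(** With complete rows, every pair [r <= c <= C] is the coordinate pair of an element, so two
    answers combine into one. *)
Definition full_triangle (C : nat) : nat := (qtri C.+1).-1.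

Lemma full_triangleP C v : (v <= full_triangle C) = (ctri v <= C).
Proof.
have [h1 h2] := ctri_rtri v; have := qtriS C; rewrite /full_triangle => qC.
case: (leqP (ctri v) C) => h; last by have := qtri_mono h; lia.
by have := @qtri_mono (ctri v).+1 C.+1 h; rewrite qtriS; lia.
Qed.

(** * The game on the triangle *)

Section Game.
Variables (C : nat).
Let n := full_triangle C.

(** Both coordinates are played on the same line {0, .., C}, so that comparisons between [rtri] and
    [ctri] are preserved too. *)
Definition matching (Z : seq (nat * nat)) (a a' : nat -> nat) : Prop :=
  [/\ (0, 0) \in Z, (C, C) \in Z &
      forall x, (ctri (a x), ctri (a' x)) \in Z /\ (rtri (a x), rtri (a' x)) \in Z].

Lemma matching_swap Z a a' : matching Z a a' -> matching (swap Z) a' a.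
Proof.
case=> h1 h2 h3; split; first by rewrite (mem_swap Z (0, 0)).
  by rewrite (mem_swap Z (C, C)).
by move=> x; have [h4 h5] := h3 x; rewrite !(mem_swap Z (_, _)).
Qed.

Lemma matching_move k Z a a' x v : similar k.+2 Z -> matching Z a a' -> v <= n ->
  exists Z' v', [/\ v' <= n, similar k Z' & matching Z' (upd a x v) (upd a' x v')].
Proof.
move=> sZ [Z0 ZC hZ] vn; have [hr _] := ctri_rtri v.
have hc : ctri v <= C by rewrite -full_triangleP.
have [c' c'C sZ1] := similar_extend sZ Z0 ZC hc.
set Z1 := (_ :: Z) in sZ1.
have sub1 p : p \in Z -> p \in Z1 by move=> pZ; rewrite inE pZ orbT.
have [r' r'C sZ2] := similar_extend sZ1 (sub1 _ Z0) (sub1 _ ZC) (leq_trans hr hc).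
set Z2 := (_ :: Z1) in sZ2.
have sub2 p : p \in Z1 -> p \in Z2 by move=> pZ; rewrite inE pZ orbT.
have rZ : (rtri v, r') \in Z2 by rewrite inE eqxx.
have cZ : (ctri v, c') \in Z2 by rewrite !inE eqxx orbT.
(* The answers form an entry of the triangle, as [r <= c] carries over. *)
have r'c' : r' <= c' by have := similar_lt sZ2 cZ rZ; rewrite /= !ltnNge hr => /esym/negbFE.
have ec : ctri (qtri c' + r') = c' by exact: (@ctri_unique _ c' r').
have er : rtri (qtri c' + r') = r' by rewrite /rtri ec addKn.
exists Z2, (qtri c' + r'); split; [by rewrite full_triangleP ec | by [] |].
split; [exact/sub2/sub1 | exact/sub2/sub1 |] => y; rewrite /upd.
by case: ifP => _; [rewrite ec er | have [h1 h2] := hZ y; split; apply/sub2/sub1].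
Qed.

Variables (sar : void -> nat).

Lemma game (f : FO_lt_tri sar) k Z a a' I I' : rank f <= k -> similar k Z ->
  matching Z a a' -> (forall z, a z <= n) -> (forall z, a' z <= n) ->
  (sat ltTri_int n I a f <-> sat ltTri_int n I' a' f).
Proof.
elim: f k Z a a' I I' => [x y|[]|b xs|f IH|f IHf g IHg|x f IH] k Z a a' I I' /= rk sZ hZ an an'.
- have [_ _ h] := hZ; have [[cx rx] [cy ry]] := (h x, h y).
  by rewrite (eq_ctri (a x)) (eq_ctri (a' x)) (similar_eq sZ cx cy) (similar_eq sZ rx ry).
- have [_ _ h] := hZ; rewrite /ltTri_ar !enum_ordSl enum_ord0 /= !an !an'.
  have [[cx rx] [cy ry]] := (h (xs ord0), h (xs (lift ord0 ord0))).
  have := similar_lt sZ cx cy; have := similar_lt sZ rx ry.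
  have := similar_eq sZ cx cy; have := similar_eq sZ rx ry.
  rewrite /= => r1 c1 r2 c2.
  have e1 : (rtri (a (xs ord0)) == rtri (a (xs (lift ord0 ord0)))) =
            (rtri (a' (xs ord0)) == rtri (a' (xs (lift ord0 ord0)))) by apply/eqP/eqP => /r1.
  have e2 : (ctri (a (xs ord0)) == ctri (a (xs (lift ord0 ord0)))) =
            (ctri (a' (xs ord0)) == ctri (a' (xs (lift ord0 ord0)))) by apply/eqP/eqP => /c1.
  case: b xs {cx rx cy ry r1 c1} e1 e2 r2 c2 => xs e1 e2 r2 c2 /=.
    by rewrite (ltn_ctri (a _)) (ltn_ctri (a' _)) e2 c2 r2.
  by rewrite /tri e1 r2 c2.
- by rewrite (IH k Z a a' I I').
- by rewrite (IHf k Z a a' I I') ?(IHg k Z a a' I I') //; lia.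
- have up_n (c : nat -> nat) v : (forall z, c z <= n) -> v <= n -> forall z, upd c x v z <= n.
    by move=> cn vn z; rewrite /upd; case: ifP.
  case: k rk sZ => [|[|k]] // rk sZ; split=> -[v [vn hv]].
    have [Z' [v' [vn' sZ' hZ']]] := matching_move x sZ hZ vn.
    by exists v'; split=> //; apply/(IH k Z' (upd a x v) _ I I') => //; exact: up_n.
  have [Z' [v' [vn' sZ' hZ']]] := matching_move x (similar_swap sZ) (matching_swap hZ) vn.
  by exists v'; split=> //; apply/(IH k Z' (upd a' x v) _ I' I) => //; exact: up_n.
Qed.
End Game.

Lemma FO_bit_not_lt_tri : exists (S : finType) (sar : S -> nat) (g : FO_bit sar),
  forall f : FO_lt_tri sar, ~ equiv_fo ltTri_int bit_int f g.
Proof.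
pose sar (s : void) := 0; exists void, sar.
(* The formula is [Bit] of variables 0 and 1; with variable 1 set to zero it expresses parity. *)
exists (@FBi void sar BitSym bit_ar SymBit (fun i : 'I_(bit_ar SymBit) => val i)) => f fg.
(* Both [c] and [c.+1] are at distance at least [2 ^ k] from the ends [0] and [C]. *)
pose k := rank f; pose c := (2 ^ k).*2; pose C := c.*2.
pose a v (x : nat) := if x == 0 then v else 0.
pose I (s : void) (t : seq nat) := false.
have K0 : 0 < 2 ^ k by rewrite expn_gt0.
have ct j : ctri (qtri j) = j by apply: (@ctri_unique _ _ 0); rewrite ?addn0.
have rt j : rtri (qtri j) = 0 by rewrite /rtri ct subnn.
have an j : j <= C -> forall z, a (qtri j) z <= full_triangle C.
  by move=> jC z; rewrite /a; case: ifP; rewrite // full_triangleP ct.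
pose Z := [:: (0, 0); (C, C); (c, c.+1)].
have sZ : similar k Z.
  by move=> p q; rewrite !inE => /or3P[] /eqP-> /or3P[] /eqP-> /=; rewrite /C /c; lia.
have mZ : matching C Z (a (qtri c)) (a (qtri c.+1)).
  split; rewrite ?inE ?eqxx ?orbT // => x; rewrite /a; case: ifP => _.
    by rewrite !ct !rt !inE !eqxx !orbT.
  have -> : 0 = qtri 0 by []. 
  by rewrite !ct !rt !inE.
have cC : c <= C /\ c.+1 <= C by rewrite /C /c; lia.
have bitE j : j <= C -> sat ltTri_int (full_triangle C) I (a (qtri j)) f <-> odd (qtri j).
  move=> jC; rewrite (fg _ _ _ (an j jC)) /= /bit_ar !enum_ordSl enum_ord0 /= -Bit0.
  by have := an j jC 0; rewrite {1}/a /= => ->; split=> [[]|].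
have G := @game C sar f k Z _ _ I I (leqnn _) sZ mZ (an _ cC.1) (an _ cC.2).
have H : odd (qtri c) <-> odd (qtri c.+1) by rewrite -!bitE ?cC.1 ?cC.2.
(* As [c] is even, the two triangular numbers differ by the odd number [c.+1]. *)
by move: H; rewrite qtriS oddD /= odd_double; case: (odd _) => -[]; intuition.
Qed.

Theorem theorem4p1 :
  (forall (S : finType) (sar : S -> nat) (f : FO_lt_tri sar),
     exists g : FO_bit sar, equiv_fo ltTri_int bit_int f g)
  /\
  (exists (S : finType) (sar : S -> nat) (g : FO_bit sar),
     forall f : FO_lt_tri sar, ~ equiv_fo ltTri_int bit_int f g).
Proof. by split; [exact: FO_lt_tri_bit | exact: FO_bit_not_lt_tri]. Qed.
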